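(* Every interval $[\sigma,\tau]$ in $\mathcal{P}$ (with $\sigma\le\tau$) is strongly Sperner.
   Context: $\mathcal{S}_n$ is the set of permutations of $\{1,\dots,n\}$ in one-line notation $\tau=\tau_1\tau_2\dots\tau_n$, with $|\tau|=n$. The reduction of a sequence of $k$ distinct positive integers is the permutation in $\mathcal{S}_k$ obtained by replacing the smallest entry by $1$, the second smallest by $2$, and so on. For $1\le i\le j\le n$, $\tau_{[i,j]}\in\mathcal{S}_{j-i+1}$ is the reduction of $\tau_i\dots\tau_j$. The consecutive pattern poset $\mathcal{P}$ is the set $\bigcup_{n\ge1}\mathcal{S}_n$ with $\sigma\le\tau$ iff $\sigma=\tau_{[i,j]}$ for some $i\le j$. For $\sigma\le\tau$, the interval $[\sigma,\tau]=\{\pi:\sigma\le\pi\le\tau\}$ is graded of rank $N=|\tau|-|\sigma|$, an element $\pi$ having rank $|\pi|-|\sigma|$. For a finite graded poset $Q$ of rank $N$, the size of rank $i$ is the number of elements of rank $i$. For a positive integer $k$, a $k$-family of $Q$ is a union of $k$ antichains. For $1\le k\le N+1$, $Q$ is $k$-Sperner if the sum of the sizes of the $k$ largest ranks equals the size of the largest $k$-family. $Q$ is strongly Sperner if it is $k$-Sperner for all $k$ with $1\le k\le N+1$. *)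

(* Defs.v *)
From HB Require Import structures.
From mathcomp Require Import all_boot all_order zify.

Set Implicit Arguments.
Unset Strict Implicit.
Unset Printing Implicit Defensive.

Import Order.TTheory.

Section FiniteGradedPosets.
Variables (d : Order.disp_t) (Q : finPOrderType d).
Implicit Types (x y z : Q) (A F : {set Q}).

Definition covers x y : bool := (x < y)%O && [forall z, ~~ (x < z < y)%O].

Record grading : Type := Grading {
  height : nat;
  rank : Q -> nat;
  rank_minimal : forall x, (forall y, (y <= x)%O -> y = x) -> rank x = 0;
  rank_maximal : forall x, (forall y, (x <= y)%O -> y = x) -> rank x = height;
  rank_covers : forall x y, covers x y -> rank y = (rank x).+1
}.

Definition antichain A : bool :=
  [forall x in A, forall y in A, (x != y) ==> (x >< y)%O].

Definition k_family (k : nat) F : bool :=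
  [exists A : {ffun 'I_k -> {set Q}},
     [forall i, antichain (A i)] && (F == \bigcup_i A i)].

Definition rank_size (g : grading) (i : nat) : nat :=
  #|[set x : Q | rank g x == i]|.

Definition rank_sizes (g : grading) : seq nat :=
  [seq rank_size g i | i <- iota 0 (height g).+1].

Definition k_Sperner (g : grading) (k : nat) : Prop :=
  \sum_(m <- take k (sort geq (rank_sizes g))) m =
  \max_(F : {set Q} | k_family k F) #|F|.

Definition strongly_Sperner (g : grading) : Prop :=
  forall k, 1 <= k <= (height g).+1 -> k_Sperner g k.

End FiniteGradedPosets.

Definition reduction (s : seq nat) : seq nat :=
  [seq (index x (sort leq s)).+1 | x <- s].

(* One-line words t_1 ... t_n of the permutations of {1, ..., n}, n >= 1. *)
Definition is_permutation (s : seq nat) : bool :=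
  (0 < size s) && perm_eq s (iota 1 (size s)).

Record permutation : Type := Permutation {
  one_line :> seq nat;
  _ : is_permutation one_line
}.

HB.instance Definition _ := [isSub for one_line].
HB.instance Definition _ := [Countable of permutation by <:].

(* [factor t i j] is the sequence t_i ... t_j, with 1-based indices. *)
Definition factor (t : seq nat) (i j : nat) : seq nat := drop i.-1 (take j t).

Definition pattern_le (s t : permutation) : bool :=
  [exists i : 'I_(size t).+1, exists j : 'I_(size t).+1,
     [&& 0 < i, i <= j & val s == reduction (factor t i j)]].

Lemma perm_uniq_one_line (t : permutation) : uniq t.
Proof. by case/andP: (valP t) => _ /perm_uniq ->; exact: iota_uniq. Qed.

Lemma size_permutation_gt0 (t : permutation) : 0 < size t.
Proof. by case/andP: (valP t). Qed.

Lemma size_reduction s : size (reduction s) = size s.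
Proof. by rewrite size_map. Qed.

Lemma reduction_permutation s :
  0 < size s -> uniq s -> is_permutation (reduction s).
Proof.
move=> s0 us; rewrite /is_permutation size_reduction s0 /=.
apply: (@perm_trans _ [seq (index x (sort leq s)).+1 | x <- sort leq s]).
  by rewrite perm_map // perm_sym perm_sort.
have us' : uniq (sort leq s) by rewrite sort_uniq.
suff -> : [seq (index x (sort leq s)).+1 | x <- sort leq s] = iota 1 (size s).
  by [].
apply: (@eq_from_nth _ 0) => [|i]; first by rewrite size_map size_sort size_iota.
rewrite size_map => lt_i; rewrite (nth_map 0) // index_uniq //.
by rewrite nth_iota // -(size_sort leq).
Qed.

Lemma reduction_id (t : permutation) : reduction t = t.
Proof.
have st : sort leq t = iota 1 (size t).
  apply: (sorted_eq leq_trans anti_leq); first exact: (sort_sorted leq_total).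
    exact: iota_sorted.
  by rewrite perm_sort; case/andP: (valP t).
rewrite /reduction st -[RHS]map_id; apply/eq_in_map => x xt.
have : x \in iota 1 (size t) by rewrite -st mem_sort.
rewrite mem_iota => /andP[x0 xn].
have lt_x : x.-1 < size t by lia.
have -> : x = nth 0 (iota 1 (size t)) x.-1 by rewrite nth_iota //; lia.
by rewrite index_uniq ?iota_uniq ?size_iota // nth_iota.
Qed.

Lemma reduction_count s : uniq s ->
  reduction s = [seq (count (fun y => y < x) s).+1 | x <- s].
Proof.
move=> us; apply/eq_in_map => x xs; congr _.+1.
have xs' : x \in sort leq s by rewrite mem_sort.
have lt_s : sorted ltn (sort leq s).
  by rewrite ltn_sorted_uniq_leq sort_uniq us (sort_sorted leq_total).
rewrite -(count_sort leq) -[in RHS](nth_index 0 xs').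
rewrite (Order.POrderTheory.count_lt_nth 0) ?index_mem //.
Qed.

Lemma reduction_mono f s : uniq s -> {in s &, {mono f : x y / x < y}} ->
  reduction (map f s) = reduction s.
Proof.
move=> us mf.
have inj_f : {in s &, injective f}.
  move=> x y xs ys fxy.
  by move: (mf _ _ xs ys) (mf _ _ ys xs); rewrite fxy ltnn; case: ltngtP.
rewrite !reduction_count ?map_inj_in_uniq // -map_comp.
apply/eq_in_map => x xs /=; rewrite count_map; congr _.+1.
by apply: eq_in_count => y ys /=; rewrite mf.
Qed.

Lemma rank_index_mono s : uniq s ->
  {in s &, {mono (fun x => (index x (sort leq s)).+1) : x y / x < y}}.
Proof.
move=> us x y; rewrite -!(mem_sort leq s) => xs ys /=; rewrite ltnS.
have lt_s : sorted ltn (sort leq s).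
  by rewrite ltn_sorted_uniq_leq sort_uniq us (sort_sorted leq_total).
have lt_index := sorted_ltn_index ltn_trans lt_s.
apply/idP/idP => [|lt_xy]; first exact: lt_index.
case: ltngtP => // [/(lt_index _ _ ys xs) lt_yx | /index_inj eq_xy].
  by rewrite ltnNge (ltnW lt_yx) in lt_xy.
by rewrite eq_xy // ltnn in lt_xy.
Qed.

Lemma reduction_infix u s : uniq s -> infix u (reduction s) ->
  exists2 v, infix v s & reduction u = reduction v.
Proof.
move=> us; set f := fun x => (index x (sort leq s)).+1.
case/infixP=> p [q eq_s].
pose v := take (size u) (drop (size p) s).
have eq_u : u = map f v.
  rewrite /v map_take map_drop -[map f s]/(reduction s) eq_s drop_size_cat //.
  by rewrite take_size_cat.
have vs : infix v s := infix_trans (infix_take _ _) (infix_drop _ _).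
exists v; rewrite // eq_u; apply: reduction_mono.
  exact: infix_uniq vs us.
by apply: sub_in2 (rank_index_mono us) => x; apply: mem_infix.
Qed.

Lemma pattern_leP (s t : permutation) :
  reflect (exists2 u, infix u t & val s = reduction u) (pattern_le s t).
Proof.
apply: (iffP existsP) => [[i /existsP[j /and3P[i0 ij /eqP es]]]|[u ut es]].
  exists (factor t i j) => //; rewrite /factor.
  exact: infix_trans (infix_drop _ _) (infix_take _ _).
have u0 : 0 < size u by rewrite -size_reduction -es size_permutation_gt0.
case/infixP: ut => p [q et].
have lej : size p + size u < (size t).+1.
  by rewrite ltnS et !size_cat addnA leq_addr.
have lei : (size p).+1 < (size t).+1.
  by apply: leq_trans lej; rewrite ltnS -addn1 leq_add2l.
exists (Ordinal lei); apply/existsP; exists (Ordinal lej) => /=.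
rewrite -addn1 leq_add2l u0 es /factor addn1 /= et catA.
by rewrite take_size_cat ?size_cat // drop_size_cat.
Qed.

Lemma pattern_le_size s t : pattern_le s t -> size s <= size t.
Proof.
by case/pattern_leP=> u /size_infix + /= ->; rewrite size_reduction.
Qed.

Lemma infix_size_eq (u s : seq nat) : infix u s -> size s <= size u -> u = s.
Proof.
case/infixP=> p [q ->]; rewrite !size_cat addnCA -[X in _ <= X]addn0 leq_add2l.
by rewrite leqn0 addn_eq0 !size_eq0 => /andP[/eqP-> /eqP->]; rewrite cats0.
Qed.

Lemma pattern_le_eq s t : pattern_le s t -> size t <= size s -> s = t.
Proof.
case/pattern_leP=> u ut es; move: (es) => /= ->.
rewrite size_reduction => /(infix_size_eq ut) eu; apply: val_inj.
by rewrite es eu reduction_id.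
Qed.

Lemma pattern_le_refl : reflexive pattern_le.
Proof.
by move=> t; apply/pattern_leP; exists t; rewrite ?infix_refl ?reduction_id.
Qed.

Lemma pattern_le_anti : antisymmetric pattern_le.
Proof.
move=> s t /andP[st ts]; apply: pattern_le_eq st _; exact: pattern_le_size.
Qed.

Lemma pattern_le_trans : transitive pattern_le.
Proof.
move=> t s r /pattern_leP[u ut es] /pattern_leP[v vr et].
rewrite et in ut; have uv := infix_uniq vr (perm_uniq_one_line r).
have [w wv ew] := reduction_infix uv ut.
by apply/pattern_leP; exists w; [exact: infix_trans vr|rewrite es].
Qed.

Fact pattern_display : Order.disp_t. Proof. exact: Order.Disp tt tt. Qed.

HB.instance Definition _ := Order.Le_isPOrder.Build pattern_display permutation
  pattern_le_refl pattern_le_anti pattern_le_trans.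

Lemma pattern_le_pred (s t : permutation) : (s < t)%O ->
  exists r : permutation, [/\ (s <= r)%O, (r <= t)%O & size t = (size r).+1].
Proof.
move=> lt_st; have /pattern_leP[u ut es] : pattern_le s t := ltW lt_st.
have u0 : 0 < size u by rewrite -size_reduction -es size_permutation_gt0.
have [v [uv vt sz]] :
    exists v, [/\ infix u v, infix v t & size (one_line t) = (size v).+1].
  case/infixP: (ut) => [[|a p] [q et]].
    case/lastP: q et => [et|q a et].
      have eut : u = t by rewrite et cats0.
      by move: lt_st; rewrite lt_neqAle -val_eqE /= es eut reduction_id eqxx.
    exists (u ++ q); rewrite et /= -rcons_cat size_rcons; split=> //.
      exact: prefix_infix.
    exact: infix_rcons.
  exists (p ++ u ++ q); rewrite et; split=> //; first exact: infix_infix.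
  exact: infix_cons.
have v0 : 0 < size v := leq_trans u0 (size_infix uv).
have v_uniq := infix_uniq vt (perm_uniq_one_line t).
exists (Permutation (reduction_permutation v0 v_uniq)); split=> /=.
- case/infixP: uv => p [q ev]; apply/pattern_leP => /=.
  set f := fun x => (index x (sort leq v)).+1.
  have uv : infix u v by rewrite ev infix_infix.
  exists (map f u).
    by rewrite /reduction -/f ev !map_cat infix_infix.
  rewrite reduction_mono // ?(infix_uniq uv) //.
  by apply: sub_in2 (rank_index_mono v_uniq) => x; apply: mem_infix.
- by apply/pattern_leP; exists v.
- by rewrite size_reduction.
Qed.

Section PatternInterval.
Variables s t : permutation.

Record pattern_interval : Type := PatternInterval {
  interval_val :> permutation;
  _ : (s <= interval_val <= t)%O
}.

HB.instance Definition _ := [isSub for interval_val].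
HB.instance Definition _ := [Countable of pattern_interval by <:].
HB.instance Definition _ :=
  [SubChoice_isSubPOrder of pattern_interval by <: with pattern_display].

Let patterns : seq (seq nat) :=
  [seq reduction (factor t i j) | i <- iota 0 (size t).+1,
                                  j <- iota 0 (size t).+1].

Fact interval_val_patterns (x : pattern_interval) :
  one_line (val x) \in patterns.
Proof.
have /andP[_ /existsP[i /existsP[j /and3P[_ _ /eqP/= ->]]]] := valP x.
by apply: allpairs_f; rewrite mem_iota /=.
Qed.

Let encode (x : pattern_interval) : seq_sub patterns :=
  SeqSub (interval_val_patterns x).
Let decode (w : seq_sub patterns) : option pattern_interval :=
  obind insub (insub (val w) : option permutation).

Fact encodeK : pcancel encode decode.
Proof. by move=> x; rewrite /decode /= (valK (val x)) /= valK. Qed.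

HB.instance Definition _ : isFinite pattern_interval := PCanIsFinite encodeK.

Definition interval_rank (x : pattern_interval) : nat := size x - size s.

Fact interval_rank_min (x : pattern_interval) :
  (forall y : pattern_interval, (y <= x)%O -> y = x) -> interval_rank x = 0.
Proof.
move=> min_x; have /andP[sx xt] := valP x.
have sP : (s <= s <= t)%O by rewrite lexx (le_trans sx).
by rewrite /interval_rank -(min_x (PatternInterval sP)) //= subnn.
Qed.

Fact interval_rank_max (x : pattern_interval) :
  (forall y : pattern_interval, (x <= y)%O -> y = x) ->
  interval_rank x = size t - size s.
Proof.
move=> max_x; have /andP[sx xt] := valP x.
have tP : (s <= t <= t)%O by rewrite lexx (le_trans sx).
by rewrite /interval_rank -(max_x (PatternInterval tP)).
Qed.

Fact interval_rank_covers (x y : pattern_interval) :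
  covers x y -> interval_rank y = (interval_rank x).+1.
Proof.
case/andP=> lt_xy /forallP cov; have /andP[sx _] := valP x.
have /andP[_ yt] := valP y.
have [r [xr ry sz]] := pattern_le_pred (lt_xy : (val x < val y)%O).
have rP : (s <= r <= t)%O by rewrite (le_trans sx) ?(le_trans ry).
set z : pattern_interval := PatternInterval rP.
have lt_zy : (z < y)%O.
  have le_zy : (z <= y)%O := ry.
  rewrite lt_neqAle le_zy andbT; apply/eqP => ezy.
  by move: sz; rewrite -ezy /=; lia.
have le_xz : (x <= z)%O := xr.
move: (cov z); rewrite lt_zy andbT lt_neqAle le_xz andbT negbK => /eqP ex.
have sz' : size y = (size z).+1 := sz.
have le_sx : size s <= size x := pattern_le_size sx.
by rewrite /interval_rank sz' -ex subSn.
Qed.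

Definition interval_grading : grading pattern_interval :=
  Grading interval_rank_min interval_rank_max interval_rank_covers.

End PatternInterval.

(* Main.v *)
Require Import Defs.
From mathcomp Require Import all_boot all_order zify.

Set Implicit Arguments.
Unset Strict Implicit.
Unset Printing Implicit Defensive.

Import Order.TTheory.

(** Label the elements of a finite graded poset by natural numbers so that
    elements with the same label form a chain and every rank with w elements
    uses only the labels 0, ..., w - 1, each at most once.  The chain of label
    c then has at most as many elements as there are ranks of size > c, so a
    k-family meets it in at most min(k, #{i : w_i > c}) elements; summing over
    c gives exactly the sum of the k largest w_i.  Since a union of k ranks is
    a k-family, such a labelling makes the poset strongly Sperner
    ([strongly_Sperner_of_label]).

    A labelling is built rank by rank ([strongly_Sperner_of_matchings]).  As
    long as rank i injects upwards into rank i + 1, every chain is continued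
    and the unmatched elements of rank i + 1 open chains with new labels.  Once
    the ranks start to shrink by one at each step, it is enough to match rank
    i + 1 down into rank i while avoiding one prescribed element, namely the
    one carrying the largest label, whose chain stops there.

    In the interval [s, t] the elements of size l are the patterns of the
    windows of length l of t that contain s, and a window of length l + 1
    extends two consecutive windows of length l.  Call a position z redundant
    at length l if the window at z does not contain s or has the same pattern
    as an earlier window.
    - If some z is redundant, send a pattern x to the right extension of its
      first window when this starts before z, and to the left extension of that
      window otherwise.  In the first case x is recovered as the prefix of its
      image, in the second as the suffix.  If the right extension of x agreed
      with the left extension of y, then y would occur at a position <= z, but
      the first occurrence of y lies beyond z.  So this is an injection into
      the next rank ([interval_up_matching]).
    - If no z is redundant, then no z is redundant at any larger length, all
      windows are pairwise distinct elements of the interval, and the top of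
      the interval is a triangular grid: position p is below positions p - 1
      and p, and the ranks have sizes w, w - 1, ..., 1.  There the matchings
      downwards are explicit ([interval_down_matching]). *)

(** * Sums of the largest terms of a sequence *)

(** Counts the cells of a Young diagram by columns instead of by rows. *)
Lemma sumn_count_gt (M : nat) (s : seq nat) : all (fun m => m <= M) s ->
  \sum_(m <- s) m = \sum_(c < M) count (fun m => c < m) s.
Proof.
elim: s => [_|m s IHs /= /andP[le_mM /IHs eq_s]].
  by rewrite big_nil big1.
rewrite big_cons eq_s big_split /=; congr (_ + _).
rewrite -{1}(card_ord m) -sum1_card (big_ord_widen _ (fun=> 1) le_mM).
by rewrite big_mkcond; apply: eq_bigr => c _; case: (c < m).
Qed.

(** In a nonincreasing sequence the terms exceeding [c] come first. *)
Lemma count_gt_take (c k : nat) (s : seq nat) : sorted geq s ->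
  count (fun m => c < m) (take k s) = minn k (count (fun m => c < m) s).
Proof.
have geq_trans : transitive geq by move=> y x z /= ? ?; lia.
elim: s k => [|m s IHs] [|k] //=; rewrite ?minn0 ?min0n // => path_s.
have [lt_cm|le_mc] := ltnP c m.
  by rewrite IHs ?(path_sorted path_s) //; lia.
have no_gt : forall u, all (geq m) u -> count (fun m' => c < m') u = 0.
  elim=> //= a u IHu /andP[le_am /IHu->]; lia.
have all_s : all (geq m) s := order_path_min geq_trans path_s.
rewrite !no_gt //; apply/allP => x /mem_take; exact: (allP all_s).
Qed.

(** * Chain labellings of graded posets *)

Lemma card_bigcup_le (I T : finType) (A : I -> {set T}) :
  #|\bigcup_i A i| <= \sum_i #|A i|.
Proof.
elim/big_rec2: _ => [|i m B _ le_B]; first by rewrite cards0.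
by apply: leq_trans (leq_card_setU _ _) _; rewrite leq_add2l.
Qed.

Section GradedPosets.
Variables (d : Order.disp_t) (Q : finPOrderType d) (g : grading Q).
Implicit Types (x y r : Q) (F : {set Q}).

Lemma rank_lt x y : (x < y)%O -> rank g x < rank g y.
Proof.
have [n] := ubnP #|[set z : Q | (x < z < y)%O]|.
elim: n x y => // n IHn x y lt_n lt_xy.
have [cov|] := boolP (covers x y); first by rewrite (rank_covers g cov).
rewrite /covers lt_xy /= negb_forall => /existsP[z]; rewrite negbK.
case/andP=> lt_xz lt_zy.
have smaller (a b : Q) : (x <= a)%O -> (b <= y)%O -> ~~ (a < z < b)%O ->
    #|[set u : Q | (a < u < b)%O]| < n.
  move=> le_xa le_by z_out; apply: leq_trans (lt_n : _ <= n).
  apply: proper_card; apply/properP; split.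
    apply/subsetP=> u; rewrite !inE => /andP[au ub].
    by rewrite (le_lt_trans le_xa au) (lt_le_trans ub le_by).
  by exists z; rewrite !inE ?lt_xz ?lt_zy.
apply: (@ltn_trans (rank g z)); apply: IHn => //; apply: smaller;
  by rewrite ?lexx ?ltW // ltxx ?andbF.
Qed.

Lemma rank_le_height x : rank g x <= height g.
Proof.
have [n] := ubnP #|[set z : Q | (x < z)%O]|.
elim: n x => // n IHn x lt_n.
have [y lt_xy|max_x] := pickP (fun y => x < y)%O; last first.
  rewrite (@rank_maximal _ _ g x) // => y; rewrite le_eqVlt max_x orbF.
  by move/eqP.
apply: leq_trans (ltnW (rank_lt lt_xy)) _; apply: IHn.
apply: leq_trans (lt_n : _ <= n); apply: proper_card; apply/properP; split.
  by apply/subsetP=> u; rewrite !inE; apply: lt_trans.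
by exists y; rewrite !inE ?ltxx.
Qed.

Lemma rank_set_antichain (i : nat) : antichain [set x : Q | rank g x == i].
Proof.
apply/'forall_implyP => x; rewrite inE => /eqP rx.
apply/'forall_implyP => y; rewrite inE => /eqP ry.
apply/implyP => neq_xy; apply/negP => /orP[];
  rewrite le_eqVlt ?[y == x]eq_sym (negPf neq_xy) => /rank_lt;
  by rewrite rx ry ltnn.
Qed.

Lemma rank_set_k_family (I : seq nat) :
  k_family (size I) [set x : Q | rank g x \in I].
Proof.
apply/existsP; exists [ffun j : 'I_(size I) => [set x | rank g x == nth 0 I j]].
apply/andP; split.
  by apply/forallP => j; rewrite ffunE; apply: rank_set_antichain.
apply/eqP/setP => x; rewrite inE; apply/idP/bigcupP => [xI|[j _]].
  have lt_i : index (rank g x) I < size I by rewrite index_mem.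
  by exists (Ordinal lt_i); rewrite // ffunE inE /= nth_index.
by rewrite ffunE inE => /eqP->; apply: mem_nth.
Qed.

Lemma card_rank_set (I : seq nat) : uniq I ->
  #|[set x : Q | rank g x \in I]| = \sum_(i <- I) rank_size g i.
Proof.
elim: I => [_|i I IHI /= /andP[iI /IHI eqI]].
  by rewrite big_nil; apply: eq_card0 => x; rewrite !inE.
have disj : [set x | rank g x == i] :&: [set x | rank g x \in I] = set0.
  by apply/setP=> x; rewrite !inE; apply/andP=> -[/eqP->]; apply/negP.
rewrite big_cons -eqI /rank_size -cardsUI disj cards0 addn0.
by congr #|pred_of_set _|; apply/setP=> x; rewrite !inE.
Qed.

Lemma k_family_chain (k : nat) F (C : {set Q}) : k_family k F ->
  {in C &, forall x y, (x >=< y)%O} -> #|F :&: C| <= k.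
Proof.
case/existsP=> A /andP[/forallP antiA /eqP->] chainC.
rewrite setIC big_distrr /=; apply: leq_trans (card_bigcup_le _) _.
rewrite -[X in _ <= X]card_ord -sum1_card.
apply: leq_sum => i _; rewrite setIC leqNgt.
apply/negP => /card_gt1P[x [y []]].
rewrite !inE => /andP[xA xC] /andP[yA yC] neq_xy.
have /forall_inP/(_ x xA)/forall_inP/(_ y yA)/implyP/(_ neq_xy) := antiA i.
by rewrite chainC.
Qed.

(** The rank is injective on each label class and only takes values [i] there
    with [rank_size g i] larger than the label; this bounds the length of the
    class by a part of the partition conjugate to the rank sizes. *)
Lemma strongly_Sperner_of_label (label : Q -> nat) :
    (forall x, label x < rank_size g (rank g x)) ->
    (forall x y, rank g x <= rank g y -> label x = label y -> (x <= y)%O) ->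
  strongly_Sperner g.
Proof.
move=> label_lt label_le k /andP[_ le_k].
pose ranks := iota 0 (height g).+1.
pose top := take k (sort (relpre (rank_size g) geq) ranks).
have eq_top : take k (sort geq (rank_sizes g)) = map (rank_size g) top.
  by rewrite /rank_sizes sort_map map_take.
have size_top : size top = k.
  by rewrite size_takel // size_sort size_iota.
have uniq_top : uniq top by rewrite take_uniq // sort_uniq iota_uniq.
apply/anti_leq/andP; split.
  rewrite eq_top big_map -card_rank_set //.
  by apply: leq_bigmax_cond; rewrite -{1}size_top rank_set_k_family.
(* Labels and rank sizes are at most [#|Q|], so both sides can be split over
   the labels [c] below that number. *)
apply/bigmax_leqP => F famF.
have le_card m : m \in rank_sizes g -> m <= #|Q|.
  by case/mapP=> i _ ->; apply: max_card.
rewrite (@sumn_count_gt #|Q|); last first.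
  by apply/allP=> m /mem_take; rewrite mem_sort; apply: le_card.
pose C c := [set x : Q | label x == c].
apply: leq_trans (_ : \sum_(c < #|Q|) #|F :&: C c| <= _).
  rewrite [X in #|pred_of_set X| <= _](_ : F = \bigcup_(c < #|Q|) (F :&: C c)).
    exact: card_bigcup_le.
  apply/setP=> x; apply/idP/bigcupP => [xF|[c _]]; last by rewrite inE => /andP[].
  have lt_x : label x < #|Q| := leq_trans (label_lt x) (max_card _).
  by exists (Ordinal lt_x); rewrite // !inE xF /=.
apply: leq_sum => c _; rewrite count_gt_take; last first.
  by apply: sort_sorted => x y; apply: leq_total.
rewrite leq_min; apply/andP; split.
  apply: k_family_chain famF _ => x y; rewrite !inE => /eqP lx /eqP ly.
  have [le_xy|/ltnW le_yx] := leqP (rank g x) (rank g y).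
    by apply/orP; left; apply: label_le; rewrite ?lx.
  by apply/orP; right; apply: label_le; rewrite ?lx.
apply: leq_trans (subset_leq_card (subsetIr _ _)) _.
rewrite count_sort count_map -size_filter cardE -(size_map (rank g)).
apply: uniq_leq_size => [|i /mapP[x]].
  rewrite map_inj_in_uniq ?enum_uniq // => x y; rewrite !mem_enum !inE.
  move=> /eqP lx /eqP ly eq_r.
  by apply: le_anti; rewrite !label_le ?eq_r ?lx.
rewrite mem_enum inE => /eqP lx ->; rewrite mem_filter mem_iota /=.
by rewrite -lx label_lt add0n ltnS rank_le_height.
Qed.

(** * Labellings from matchings between consecutive ranks *)

Definition up_matching (i : nat) : Prop := exists f : Q -> Q,
  [/\ forall x, rank g x = i -> rank g (f x) = i.+1,
      forall x, rank g x = i -> (x <= f x)%O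
    & {in [pred x | rank g x == i] &, injective f}].

Definition down_matching_avoiding (i : nat) r : Prop := exists f : Q -> Q,
  [/\ forall y, rank g y = i.+1 -> rank g (f y) = i /\ f y != r,
      forall y, rank g y = i.+1 -> (f y <= y)%O
    & {in [pred y | rank g y == i.+1] &, injective f}].

Section Labelling.
Variable i : nat.

(** A chain labelling of the ranks up to [i]. *)
Definition labelling (label : Q -> nat) : Prop :=
  (forall x, rank g x <= i -> label x < rank_size g (rank g x)) /\
  (forall x y, rank g x <= rank g y <= i -> label x = label y -> (x <= y)%O).

Lemma labelling_inj (label : Q -> nat) x y : labelling label ->
  rank g x = rank g y -> rank g y <= i -> label x = label y -> x = y.
Proof.
case=> _ label_le eq_r le_i eq_l.
by apply: le_anti; rewrite !label_le // eq_r leqnn.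
Qed.

End Labelling.

Lemma labelling0 : exists2 label, labelling 0 label &
  forall x, rank g x <= 0 -> label x < rank_size g 0.
Proof.
pose label x := index x (enum [set x : Q | rank g x == 0]).
have lt_label x : rank g x <= 0 -> label x < rank_size g 0.
  by move=> rx; rewrite /rank_size cardE index_mem mem_enum inE; lia.
exists label => //; split=> [x rx|x y /andP[rxy ry] eq_l].
  by rewrite (_ : rank g x = 0) ?lt_label //; lia.
have in_label0 z : rank g z <= 0 -> z \in enum [set x : Q | rank g x == 0].
  by rewrite mem_enum inE leqn0.
by rewrite (index_inj x (in_label0 x _) (in_label0 y ry) eq_l) //; lia.
Qed.

(** An element of rank [i.+1] inherits the label of the element matched to it;
    the others get the labels from [rank_size g i] on, which are new because
    all labels used so far are smaller. *)
Lemma labelling_up (i : nat) (label : Q -> nat) : labelling i label ->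
    (forall x, rank g x <= i -> label x < rank_size g i) -> up_matching i ->
  exists2 label', labelling i.+1 label' &
    forall x, rank g x <= i.+1 -> label' x < rank_size g i.+1.
Proof.
move=> lab lt_i [f [rank_f le_f inj_f]].
pose L j := [set x : Q | rank g x == j].
have f_sub : f @: L i \subset L i.+1.
  by apply/subsetP=> y /imsetP[x]; rewrite !inE => /eqP rx ->; rewrite rank_f.
have card_f : #|f @: L i| = rank_size g i.
  by apply: card_in_imset => x y; rewrite !inE => rx ry; apply: inj_f.
pose U := L i.+1 :\: f @: L i.
have card_U : rank_size g i.+1 = rank_size g i + #|U|.
  by have := cardsID (f @: L i) (L i.+1); rewrite (setIidPr f_sub) card_f.
pose label' y := if rank g y <= i then label y else
  if [pick x in L i | f x == y] is Some x then label x
  else rank_size g i + index y (enum U).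
have label'_low y : rank g y <= i -> label' y = label y by rewrite /label' => ->.
have label'_top y : rank g y = i.+1 ->
    (exists x, [/\ rank g x = i, f x = y & label' y = label x]) \/
    (y \in U /\ label' y = rank_size g i + index y (enum U)).
  move=> ry; rewrite /label' ry ltnn; case: pickP => [x|no_x].
    by rewrite inE => /andP[/eqP rx /eqP fx]; left; exists x.
  right; split=> //; rewrite !inE ry eqxx andbT; apply/imsetP => -[x xL fx].
  by move: (no_x x); rewrite xL fx eqxx.
have lt_label' x : rank g x <= i.+1 -> label' x < rank_size g i.+1.
  rewrite leq_eqVlt ltnS => /orP[/eqP rx|rx].
    rewrite card_U; case: (label'_top x rx) => [[x0 [rx0 _ ->]]|[xU ->]].
      by rewrite ltn_addr // lt_i ?rx0.
    by rewrite ltn_add2l cardE index_mem mem_enum.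
  by rewrite label'_low // card_U ltn_addr // lt_i.
exists label' => //; split=> [x|x y /andP[rxy]].
  rewrite leq_eqVlt ltnS => /orP[/eqP rx|rx]; first by rewrite rx lt_label' ?rx.
  by rewrite label'_low //; case: lab => + _; apply.
rewrite leq_eqVlt ltnS => /orP[/eqP ry|ry]; last first.
  rewrite !label'_low ?(leq_trans rxy) //; case: lab => _ label_le.
  by apply: label_le; rewrite rxy.
have [rx|rx] : rank g x = i.+1 \/ rank g x <= i by lia.
  case: (label'_top x rx) => [[x0 [rx0 <- ->]]|[xU ->]];
    case: (label'_top y ry) => [[y0 [ry0 <- ->]]|[yU ->]] eq_l.
  - by rewrite (labelling_inj lab _ _ eq_l) // ?rx0 ry0.
  - by have := lt_i x0; rewrite rx0 eq_l leqnn; lia.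
  - by have := lt_i y0; rewrite ry0 -eq_l leqnn; lia.
  - rewrite -!(mem_enum U) in xU yU.
    by rewrite (index_inj x xU yU (addnI eq_l)).
rewrite label'_low //.
case: (label'_top y ry) => [[y0 [ry0 <- ->]]|[yU ->]] eq_l.
  apply: le_trans (le_f y0 ry0); case: lab => _; apply=> //.
  by rewrite ry0 rx leqnn.
by have := lt_i x rx; lia.
Qed.

(** Every element of rank [i.+1] inherits the label of the element matched
    below it.  Since rank [i.+1] may be smaller than rank [i] by one, the
    label [(rank_size g i).-1] must not be inherited. *)
Lemma labelling_down (i : nat) (label : Q -> nat) : labelling i label ->
    rank_size g i <= (rank_size g i.+1).+1 ->
    (forall r, down_matching_avoiding i r) ->
  exists label', labelling i.+1 label'.
Proof.
move=> lab size_i down.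
have [x0 _|Q0] := pickP (@predT Q); last first.
  by exists (fun=> 0); split=> [x|x]; have := Q0 x.
pose last_of r := (rank g r == i) && (label r == (rank_size g i).-1).
(* If no element of rank [i] carries the last label, nothing has to be avoided
   and the default [x0] serves only to provide a matching. *)
pose r := odflt x0 [pick r | last_of r].
have [f [rank_f le_f inj_f]] := down r.
have lt_f y : rank g y = i.+1 -> label (f y) < rank_size g i.+1.
  move=> /rank_f[rfy neq_r].
  have lt_fy : label (f y) < rank_size g i.
    by rewrite -[in X in _ < X]rfy; case: lab => + _; apply; rewrite rfy.
  suff : label (f y) != (rank_size g i).-1 by lia.
  apply: contraNneq neq_r => eq_l; rewrite /r.
  case: pickP => [r' /andP[/eqP rr' /eqP lr']|/(_ (f y))]; last first.
    by rewrite /last_of rfy eq_l !eqxx.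
  by apply/eqP; apply: labelling_inj lab _ _ _; rewrite ?rr' ?rfy ?lr'.
exists (fun y => if rank g y <= i then label y else label (f y)).
split=> [x|x y /andP[rxy]].
  rewrite leq_eqVlt ltnS => /orP[/eqP rx|rx]; first by rewrite rx ltnn lt_f.
  by rewrite rx; case: lab => + _; apply.
rewrite leq_eqVlt ltnS => /orP[/eqP ry|ry]; last first.
  rewrite ry (leq_trans rxy ry); case: lab => _ label_le.
  by apply: label_le; rewrite rxy.
have [rfy _] := rank_f y ry.
have [rx|rx] : rank g x = i.+1 \/ rank g x <= i by lia.
  rewrite rx ry ltnn => eq_l; have [rfx _] := rank_f x rx.
  suff -> : x = y by [].
  by apply: inj_f; rewrite ?inE ?rx ?ry //; apply: labelling_inj lab _ _ _;
    rewrite ?rfx ?rfy.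
rewrite ry ltnn rx => eq_l; apply: le_trans (le_f y ry).
by case: lab => _; apply; rewrite ?rfy ?rx /=.
Qed.

(** The predicate [past_peak] holds on a final segment of the ranks.  Below it,
    the labels at ranks up to [i] are all less than [rank_size g i], which
    keeps the labels opened at rank [i.+1] disjoint from the earlier ones;
    beyond it no label is ever opened again. *)
Lemma strongly_Sperner_of_matchings (past_peak : pred nat) :
    (forall i, i < height g -> ~~ past_peak i -> up_matching i) ->
    (forall i, i < height g -> past_peak i ->
       [/\ past_peak i.+1, rank_size g i <= (rank_size g i.+1).+1
         & forall r, down_matching_avoiding i r]) ->
  strongly_Sperner g.
Proof.
move=> up down.
have labelled i : i <= height g -> exists2 label, labelling i label &
    ~~ past_peak i -> forall x, rank g x <= i -> label x < rank_size g i.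
  elim: i => [_|i IHi lt_i].
    by have [label lab lt0] := labelling0; exists label.
  have [label lab lt_label] := IHi (ltnW lt_i).
  have [Bi|nBi] := boolP (past_peak i).
    have [Bi1 size_i down_i] := down i lt_i Bi.
    have [label' lab'] := labelling_down lab size_i down_i.
    by exists label'; rewrite ?Bi1.
  have [label' lab' lt'] := labelling_up lab (lt_label nBi) (up i lt_i nBi).
  by exists label'.
have [label [lt_label le_label] _] := labelled _ (leqnn _).
apply: (@strongly_Sperner_of_label label) => [x|x y rxy].
  by apply: lt_label; apply: rank_le_height.
by apply: le_label; rewrite rxy rank_le_height.
Qed.

End GradedPosets.

(** * Windows of a permutation *)

(** Standardizing [u] does not change the relative order of the entries of its
    factors. *)
Lemma reduction_map_index (u v : seq nat) : uniq u -> infix v u ->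
  reduction [seq (index x (sort leq u)).+1 | x <- v] = reduction v.
Proof.
move=> uu vu; apply: reduction_mono; first exact: infix_uniq vu uu.
by apply: sub_in2 (rank_index_mono uu) => x; apply: mem_infix.
Qed.

Lemma reduction_take (l : nat) (u : seq nat) : uniq u ->
  reduction (take l (reduction u)) = reduction (take l u).
Proof.
by move=> uu; rewrite -map_take reduction_map_index ?infix_take.
Qed.

Lemma reduction_drop (l : nat) (u : seq nat) : uniq u ->
  reduction (drop l (reduction u)) = reduction (drop l u).
Proof.
by move=> uu; rewrite -map_drop reduction_map_index ?infix_drop.
Qed.

Section Windows.
Variable t : permutation.

(** The pattern of [t] at the [l] positions from [p] on, counted from 0.  The
    value [t] is a default for empty words. *)
Definition window (l p : nat) : permutation :=
  insubd t (reduction (take l (drop p t))).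

Lemma val_window l p : 0 < l -> p + l <= size t ->
  val (window l p) = reduction (take l (drop p t)).
Proof.
move=> l0 le_t; rewrite val_insubd reduction_permutation //.
  by rewrite size_take size_drop; case: (ltnP l) => /=; lia.
by rewrite take_uniq // drop_uniq // perm_uniq_one_line.
Qed.

Lemma size_window l p : 0 < l -> p + l <= size t -> size (window l p) = l.
Proof.
move=> l0 le_t; rewrite [one_line _]val_window // size_reduction size_takel //.
rewrite size_drop /=; lia.
Qed.

Lemma window_le l p : 0 < l -> p + l <= size t -> (window l p <= t)%O.
Proof.
move=> l0 le_t; apply/pattern_leP; exists (take l (drop p t)).
  exact: infix_trans (infix_take _ _) (infix_drop _ _).
exact: val_window.
Qed.

Lemma window_prefix l p : 0 < l -> p + l.+1 <= size t ->
  val (window l p) = reduction (take l (window l.+1 p)).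
Proof.
move=> l0 le_t; rewrite (val_window l0) /=; last lia.
have -> : one_line (window l.+1 p) = _ := val_window (ltn0Sn l) le_t.
rewrite reduction_take; first by rewrite take_takel.
by rewrite take_uniq // drop_uniq // perm_uniq_one_line.
Qed.

Lemma window_suffix l p : 0 < l -> p + l.+1 <= size t ->
  val (window l p.+1) = reduction (drop 1 (window l.+1 p)).
Proof.
move=> l0 le_t; rewrite (val_window l0) /=; last lia.
have -> : one_line (window l.+1 p) = _ := val_window (ltn0Sn l) le_t.
rewrite reduction_drop.
  by rewrite -[l.+1]addn1 -take_drop drop_drop add1n.
by rewrite take_uniq // drop_uniq // perm_uniq_one_line.
Qed.

Lemma window_prefix_le l p : 0 < l -> p + l.+1 <= size t ->
  (window l p <= window l.+1 p)%O.
Proof.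
move=> l0 le_t; apply/pattern_leP; eexists; last exact: window_prefix.
exact: infix_take.
Qed.

Lemma window_suffix_le l p : 0 < l -> p + l.+1 <= size t ->
  (window l p.+1 <= window l.+1 p)%O.
Proof.
move=> l0 le_t; apply/pattern_leP; eexists; last exact: window_suffix.
exact: infix_drop.
Qed.

Lemma eq_window_prefix l p q : 0 < l -> p + l.+1 <= size t ->
  q + l.+1 <= size t -> window l.+1 p = window l.+1 q -> window l p = window l q.
Proof.
move=> l0 le_p le_q eq_w; apply: val_inj.
by rewrite (window_prefix l0 le_p) (window_prefix l0 le_q) eq_w.
Qed.

Lemma eq_window_suffix l p q : 0 < l -> p + l.+1 <= size t ->
  q + l.+1 <= size t -> window l.+1 p = window l.+1 q ->
  window l p.+1 = window l q.+1.
Proof.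
move=> l0 le_p le_q eq_w; apply: val_inj.
by rewrite (window_suffix l0 le_p) (window_suffix l0 le_q) eq_w.
Qed.

(** The first occurrence of [x] in [t], counted from 0. *)
Definition position (x : permutation) : nat :=
  find (fun p => window (size x) p == x) (iota 0 (size t - size x).+1).

Lemma has_position (x : permutation) : (x <= t)%O ->
  has (fun p => window (size x) p == x) (iota 0 (size t - size x).+1).
Proof.
move=> le_xt; have /pattern_leP[u /infixP[a [b et]] ex] : pattern_le x t := le_xt.
have sz : size t = size a + (size u + size b) by rewrite [in LHS]et !size_cat.
have szx : size x = size u by rewrite [one_line x]ex size_reduction.
have x0 := size_permutation_gt0 x.
apply/hasP; exists (size a); first by rewrite mem_iota; lia.
apply/eqP/val_inj; rewrite val_window //; last lia.
by rewrite [in drop _ _]et drop_size_cat // szx take_size_cat.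
Qed.

Lemma position_le (x : permutation) : (x <= t)%O ->
  position x + size x <= size t.
Proof.
move=> le_xt; have := has_position le_xt; rewrite has_find size_iota ltnS.
have := pattern_le_size le_xt; rewrite -/(position x); lia.
Qed.

Lemma window_position (x : permutation) : (x <= t)%O ->
  window (size x) (position x) = x.
Proof.
move=> le_xt; have := nth_find 0 (has_position le_xt).
have := has_position le_xt; rewrite has_find size_iota => lt_pos.
by rewrite nth_iota // => /eqP.
Qed.

Lemma position_min (x : permutation) p : p + size x <= size t ->
  window (size x) p = x -> position x <= p.
Proof.
move=> le_p eq_p; rewrite leqNgt; apply/negP => lt_p.
have := before_find 0 lt_p; rewrite nth_iota; last lia.
by rewrite add0n eq_p eqxx.
Qed.

End Windows.

(** * Matchings in an interval *)

Section Interval.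
Variables s t : permutation.
Local Notation g := (interval_grading s t).
Implicit Types x y r : pattern_interval s t.

Lemma interval_sub_le x : (s <= interval_val x)%O /\ (interval_val x <= t)%O.
Proof. exact: (andP (valP x)). Qed.

Lemma interval_val_inj : injective (@interval_val s t).
Proof. exact: val_inj. Qed.

Lemma size_interval x : size x = size s + rank g x.
Proof.
have [/pattern_le_size le_sx _] := interval_sub_le x.
by apply/esym/subnKC.
Qed.

Definition redundant (l z : nat) : bool :=
  ~~ (s <= window t l z)%O || [exists p : 'I_z, window t l p == window t l z].

Definition rigid (l : nat) : bool :=
  [forall z : 'I_(size t - l).+1, ~~ redundant l z].

Lemma rigidP l : reflect (forall z, z <= size t - l ->
    (s <= window t l z)%O /\ forall p, p < z -> window t l p <> window t l z)
  (rigid l).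
Proof.
apply: (iffP forallP) => [rig z le_z|rig z].
  have := rig (Ordinal (le_z : z < _.+1)); rewrite negb_or negbK negb_exists /=.
  case/andP=> -> /forallP no_p; split=> // p lt_p eq_p.
  by have := no_p (Ordinal lt_p); rewrite eq_p eqxx.
have [le_s no_p] := rig z (ltn_ord z); rewrite negb_or negbK le_s /=.
by apply/existsPn => p; apply/eqP; apply: no_p; apply: ltn_ord.
Qed.

Lemma rigid_inj l p q : rigid l -> p <= size t - l -> q <= size t - l ->
  window t l p = window t l q -> p = q.
Proof.
move=> /rigidP rig le_p le_q eq_w; case: (ltngtP p q) => // lt_pq.
  by have [_ /(_ p lt_pq)] := rig q le_q.
by have [_ /(_ q lt_pq)] := rig p le_p; rewrite eq_w.
Qed.

(** A window of length [l.+1] contains the window of length [l] at the same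
    position and determines its pattern. *)
Lemma rigidS l : 0 < l < size t -> rigid l -> rigid l.+1.
Proof.
case/andP=> l0 lt_l rig; apply/rigidP => z le_z; split=> [|p lt_p eq_w].
  apply: le_trans (window_prefix_le l0 _); last lia.
  by have [] := rigidP _ rig z; first lia.
have /(rigid_inj rig) : window t l p = window t l z.
  by apply: eq_window_prefix eq_w; lia.
lia.
Qed.

(** An element is determined by its first position, and there are
    [size t - l + 1] positions for windows of length [l]. *)
Lemma rank_size_le i : size s + i <= size t ->
  rank_size g i <= (size t - (size s + i)).+1.
Proof.
move=> le_i; rewrite -[X in _ <= X]card_ord.
pose f x : 'I_(size t - (size s + i)).+1 := inord (position t x).
rewrite /rank_size -(@card_in_imset _ _ f) ?max_card // => x y; rewrite !inE.
move=> /eqP rx /eqP ry.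
have [_ xt] := interval_sub_le x; have [_ yt] := interval_sub_le y.
have := position_le xt; have := position_le yt.
have := size_interval x; have := size_interval y; rewrite rx ry => sy sx py px.
move/(congr1 (@nat_of_ord _)); rewrite !inordK ?ltnS; [|lia|lia] => eq_p.
apply: interval_val_inj; rewrite -(window_position xt) -(window_position yt).
by rewrite eq_p sx sy.
Qed.

Lemma rank_size_rigid i : size s + i <= size t -> rigid (size s + i) ->
  (size t - (size s + i)).+1 <= rank_size g i.
Proof.
move=> le_i rig; have s0 := size_permutation_gt0 s.
have wP (p : 'I_(size t - (size s + i)).+1) :
    (s <= window t (size s + i) p <= t)%O.
  have lt_p := ltn_ord p; have [-> _] := rigidP _ rig p lt_p.
  by apply: window_le; lia.
pose f p := PatternInterval (wP p).
rewrite -[X in X <= _]card_ord /rank_size -(@card_imset _ _ f) => [|p q].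
  apply: subset_leq_card; apply/subsetP => _ /imsetP[p _ ->].
  rewrite inE /= /interval_rank size_window; have := ltn_ord p; lia.
move/(congr1 val) => /= /(rigid_inj rig) eq_p.
by apply: val_inj; apply: eq_p; have := ltn_ord p; have := ltn_ord q; lia.
Qed.

(** Extend each element of rank [i] by one entry towards a redundant position
    [z], starting from its first occurrence. *)
Lemma interval_up_matching i : i < height g -> ~~ rigid (size s + i) ->
  up_matching g i.
Proof.
move=> lt_i /forallPn[[z /= lt_z]]; rewrite negbK.
set l := size s + i => red_z; rewrite /= in lt_i.
have s0 := size_permutation_gt0 s.
have l0 : 0 < l by lia.
have l_eq x : rank g x = i -> size x = l by move=> rx; rewrite size_interval rx.
pose start x := if position t x < z then position t x else (position t x).-1.
pose f x : pattern_interval s t := insubd x (window t l.+1 (start x)).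
(* The first occurrence of [x] is not at [z]: the window there is not in the
   interval or occurs earlier.  Hence extending towards [z] stays inside [t]. *)
have pos_x x : rank g x = i -> [/\ position t x + l <= size t,
    window t l (position t x) = interval_val x & position t x != z].
  move=> /l_eq sx; have [sxle xt] := interval_sub_le x.
  have px := position_le xt; have wx := window_position xt.
  rewrite sx in px wx; split=> //; apply/eqP => eq_z.
  case/orP: red_z => [|/existsP[p /eqP eq_w]]; first by rewrite -eq_z wx sxle.
  have lt_p := ltn_ord p; have : position t x <= p; last lia.
  by apply: position_min; rewrite sx ?eq_w -?eq_z //; lia.
have start_le x : rank g x = i -> start x + l.+1 <= size t.
  by case/pos_x=> px wx /eqP neq_z; rewrite /start; case: ltnP; lia.
have le_start x : rank g x = i -> (interval_val x <= window t l.+1 (start x))%O.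
  move=> rx; have st := start_le x rx; have [px wx /eqP neq_z] := pos_x x rx.
  suff : (window t l (position t x) <= window t l.+1 (start x))%O by rewrite wx.
  move: st; rewrite /start; case: ltnP => lt_pz st.
    exact: window_prefix_le.
  have eq_p : position t x = (position t x).-1.+1 by lia.
  by rewrite [X in (window t l X <= _)%O]eq_p window_suffix_le.
have val_f x : rank g x = i -> interval_val (f x) = window t l.+1 (start x).
  move=> rx; rewrite -[LHS]/(val (f x)) val_insubd.
  rewrite window_le //; last exact: start_le.
  by have [sx _] := interval_sub_le x; rewrite (le_trans sx (le_start x rx)).
exists f; split=> [x rx|x rx|x y].
- apply/eqP; rewrite -(eqn_add2l (size s)) -size_interval.
  by rewrite val_f // size_window ?start_le // addnS.
- by rewrite leEsub /= val_f // le_start.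
rewrite !inE => /eqP rx /eqP ry /(congr1 (@interval_val s t)); rewrite !val_f //.
wlog le_pos : x y rx ry / position t x <= position t y.
  have [le_xy|/ltnW le_yx] := leqP (position t x) (position t y) => wl eq_w.
    exact: wl.
  by apply/esym; apply: wl.
move=> eq_w; have sx := start_le x rx; have sy := start_le y ry.
have [px wx /eqP zx] := pos_x x rx; have [py wy /eqP zy] := pos_x y ry.
have pre := eq_window_prefix l0 sx sy eq_w.
have suf := eq_window_suffix l0 sx sy eq_w.
apply: interval_val_inj; rewrite -wx -wy.
move: sx sy pre suf; rewrite /start.
(* Two right extensions share their prefix, two left extensions their suffix.
   In the mixed case [y], whose first occurrence is beyond [z], would also be
   the window at [position t x + 1 <= z]. *)
case: (ltnP (position t y) z) => lt_y.
  by rewrite (leq_ltn_trans le_pos lt_y).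
case: (ltnP (position t x) z) => lt_x sx sy; last first.
  by rewrite !prednK //; lia.
move=> _; rewrite (@prednK (position t y)) ?wy => [suf|]; last lia.
have : position t y <= (position t x).+1.
  by apply: position_min; rewrite l_eq //; lia.
lia.
Qed.

(** When the windows are distinct, position [p] of rank [i.+1] lies above
    positions [p] and [p.+1] of rank [i]; taking the former before the position
    of [r] and the latter from there on skips exactly that position. *)
Lemma interval_down_matching i r : i < height g -> rigid (size s + i) ->
  down_matching_avoiding g i r.
Proof.
set l := size s + i => lt_i rig; rewrite /= in lt_i.
have s0 := size_permutation_gt0 s.
have l0 : 0 < l by lia.
pose start y := if position t y < position t r then position t y
  else (position t y).+1.
pose f y : pattern_interval s t := insubd y (window t l (start y)).
have pos_y y : rank g y = i.+1 -> position t y + l.+1 <= size t /\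
    window t l.+1 (position t y) = interval_val y.
  move=> ry; have sy : size y = l.+1 by rewrite size_interval ry addnS.
  have [_ yt] := interval_sub_le y.
  have := position_le yt; have := window_position yt.
  by rewrite sy.
have start_le y : rank g y = i.+1 -> start y <= size t - l.
  by move=> /pos_y[py _]; rewrite /start; case: ifP; lia.
have val_f y : rank g y = i.+1 -> interval_val (f y) = window t l (start y).
  move=> ry; rewrite -[LHS]/(val (f y)) val_insubd window_le ?andbT //; last first.
    have := start_le y ry; lia.
  by have [-> _] := rigidP _ rig _ (start_le y ry).
exists f; split=> [y ry|y ry|x y].
- split; last first.
    apply/eqP => /(congr1 (@interval_val s t)); rewrite val_f // => eq_r.
    have st := start_le y ry.
    have sr : size r = l by rewrite -eq_r size_window //; lia.
    have [_ rt] := interval_sub_le r.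
    have := position_le rt; have := window_position rt; rewrite sr -{2}eq_r.
    move=> eq_w pr; have /(rigid_inj rig) : window t l (position t r) =
      window t l (start y) by [].
    by rewrite /start in st *; case: ifP st; lia.
  apply/eqP; rewrite -(eqn_add2l (size s)) -size_interval.
  by rewrite val_f // size_window //; have := start_le y ry; lia.
- rewrite leEsub /= val_f //; have [py wy] := pos_y y ry.
  suff : (window t l (start y) <= window t l.+1 (position t y))%O by rewrite wy.
  rewrite /start; case: ifP => _.
    exact: window_prefix_le.
  exact: window_suffix_le.
rewrite !inE => /eqP rx /eqP ry /(congr1 (@interval_val s t)); rewrite !val_f //.
move/(rigid_inj rig (start_le x rx) (start_le y ry)) => eq_st.
have [_ wx] := pos_y x rx; have [_ wy] := pos_y y ry.
apply: interval_val_inj; rewrite -wx -wy; congr window.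
move: eq_st; rewrite /start.
by case: (ltnP (position t x)); case: (ltnP (position t y)); lia.
Qed.

End Interval.

Theorem theorem5p6 (s t : permutation) (hst : (s <= t)%O) :
  strongly_Sperner (interval_grading s t).
Proof.
have s0 := size_permutation_gt0 s.
apply: (@strongly_Sperner_of_matchings _ _ _ (fun i => rigid s t (size s + i))).
  by move=> i lt_i; apply: interval_up_matching.
move=> i lt_i rig; have lt_t : size s + i < size t by move: lt_i => /=; lia.
have rig' : rigid s t (size s + i.+1) by rewrite addnS rigidS //; lia.
split=> // [|r]; last exact: interval_down_matching.
have le_t : size s + i.+1 <= size t by lia.
have := rank_size_le (ltnW lt_t); have := rank_size_rigid le_t rig'.
lia.
Qed.
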